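(* Let $(X,\tau_X)$ be a Polish space and $T:X\to X$ be $\tau_X$-continuous. Assume $X$ is endowed with a Hausdorff topology $\tau$ coarser than $\tau_X$ such that every point has a $\tau_X$-neighbourhood basis consisting of $\tau$-compact sets, and that $T$ is continuous with respect to $\tau$. Then the following are equivalent: (1) $T$ admits an invariant Borel probability measure with full support; (2) for each nonempty open set $V$ there is an ergodic measure $\mu_V$ for $T$ with $\mu_V(V)>0$; (3) $T$ is frequently recurrent.
   Context: $T$ is frequently recurrent if for every nonempty open $V\subset X$ there exists $x_V\in V$ such that $\{n\in\mathbb N: T^nx_V\in V\}$ has positive lower density (lower density $\liminf_N\frac1N\#(D\cap[1,N])$). Open sets and full support refer to $\tau_X$. *)

(* Defs.v *)
From HB Require Import structures.
From mathcomp Require Import all_boot all_order all_algebra.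
From mathcomp Require Import all_classical all_reals all_analysis.
Set Implicit Arguments. Unset Strict Implicit. Unset Printing Implicit Defensive.
Import Order.TTheory GRing.Theory Num.Theory.
Local Open Scope classical_set_scope.
Local Open Scope ring_scope.

Notation borel_of X := (g_sigma_algebraType (@open X)).

Section Defs.
Context (R : realType).

Definition compatible_metric (X : topologicalType) (d : X -> X -> R) : Prop :=
  [/\ (forall x y, 0 <= d x y),
      (forall x y, d x y = 0 <-> x = y),
      (forall x y, d x y = d y x),
      (forall x y z, d x z <= d x y + d y z) &
      (forall A : set X, open A <->
         (forall x, A x -> exists2 e : R, 0 < e & [set y | d x y < e] `<=` A))].

Definition complete_metric (X : topologicalType) (d : X -> X -> R) : Prop :=
  forall u : nat -> X,
    (forall e : R, 0 < e -> exists N, forall m n, (N <= m)%N -> (N <= n)%N ->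
        d (u m) (u n) < e) ->
    exists l : X, u @ \oo --> l.

Definition polish (X : topologicalType) : Prop :=
  (exists D : set X, countable D /\ closure D = setT) /\
  (exists d : X -> X -> R, compatible_metric d /\ complete_metric d).
End Defs.

Section Topo.
Context (X : Type).

Definition is_topology (tau : set (set X)) : Prop :=
  [/\ tau setT, tau set0,
      (forall (I : Type) (F : I -> set X), (forall i, tau (F i)) ->
          tau (\bigcup_(i in [set: I]) F i)) &
      (forall A B, tau A -> tau B -> tau (A `&` B))].

Definition hausdorff_top (tau : set (set X)) : Prop :=
  forall x y : X, x <> y ->
    exists U V, [/\ tau U, tau V, U x, V y & U `&` V = set0].

Definition compact_top (tau : set (set X)) (K : set X) : Prop :=
  forall (I : Type) (F : I -> set X), (forall i, tau (F i)) ->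
    K `<=` \bigcup_(i in [set: I]) F i ->
    exists2 J : set I, finite_set J & K `<=` \bigcup_(i in J) F i.

Definition continuous_top (tau : set (set X)) (T : X -> X) : Prop :=
  forall U, tau U -> tau (T @^-1` U).
End Topo.

Section Dyn.
Context (R : realType) (X : ptopologicalType).
Local Open Scope ereal_scope.

Definition invariant_measure (T : X -> X)
    (mu : set (borel_of X) -> \bar R) : Prop :=
  forall A : set (borel_of X), measurable A -> mu (T @^-1` A) = mu A.

Definition full_support (mu : set (borel_of X) -> \bar R) : Prop :=
  forall V : set X, open V -> V !=set0 -> 0 < mu V.

Definition ergodic_measure (T : X -> X)
    (mu : probability (borel_of X) R) : Prop :=
  invariant_measure T mu /\
  forall A : set (borel_of X), measurable A -> T @^-1` A = A ->
    mu A = 0 \/ mu A = 1.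

Definition visits (T : X -> X) (x : X) (V : set X) (N : nat) : nat :=
  count (fun n => `[< V (iter n T x) >]) (iota 1 N).

Definition lower_density_visits (T : X -> X) (x : X) (V : set X) : \bar R :=
  limn_einf (fun N => ((visits T x V N)%:R / N%:R)%:E).

Definition frequently_recurrent (T : X -> X) : Prop :=
  forall V : set X, open V -> V !=set0 ->
    exists2 x, V x & 0 < lower_density_visits T x V.
End Dyn.

(* Main.v *)
Require Import Defs.
From HB Require Import structures.
From mathcomp Require Import all_boot all_order all_algebra.
From mathcomp Require Import all_classical all_reals all_analysis.
From mathcomp Require Import measurable_realfun lra.
Import Order.TTheory GRing.Theory Num.Theory.
Import numFieldNormedType.Exports.
Set Implicit Arguments.
Unset Strict Implicit.
Unset Printing Implicit Defensive.
Local Open Scope classical_set_scope.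
Local Open Scope ring_scope.

(** Invariant measures are produced from finitely additive limits. Let [m] be
an ultrafilter limit of averages which is finitely additive and [T]-invariant.
Restricting [m] to the [tau]-open sets gives a content on the [tau]-compact
sets, [K |-> inf {m U | K `<=` U}], and the usual inner and outer
approximations turn it into a measure [mu] for which all [tau]-open sets are
Caratheodory measurable; no local compactness is needed. As every open set is a
countable union of [tau]-compact sets, [mu] is a Borel measure. It satisfies
[m K <= mu K] on [tau]-compact sets and [mu (T @^-1` A) <= mu A] on all sets;
passing to complements, [mu] is invariant.

(1) => (2): this compactness makes the maximum of [mu (K 0)], then of
[mu (K 1)], and so on, attained among the invariant probabilities, for a
countable family of [tau]-compact sets which determines Borel measures and
starts with a neighbourhood [K 0] contained in [V]. The lexicographic maximiser
is an extreme point, hence ergodic, and it charges [V].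

(2) => (3): if every point of [V] had lower density [0], every orbit would have
initial segments with an arbitrarily small frequency of visits to [V], and
cutting long orbits into such segments would give [mu V = 0].

(3) => (1): the averages along an orbit which visits a [tau]-compact subset of
[V] with positive lower density give an invariant measure charging [V]; a
countable convex combination of such measures has full support. *)

(** * Compact sets of a topology given by its open sets *)

Section topology_of_opens.
Context (X : Type) (tau : set (set X)).
Hypothesis tauP : is_topology tau.

Lemma tauT : tau setT. Proof. by case: tauP. Qed.

Lemma tau0 : tau set0. Proof. by case: tauP. Qed.

Lemma tauI A B : tau A -> tau B -> tau (A `&` B).
Proof. by case: tauP => _ _ _; apply. Qed.

Lemma tau_bigcup I (F : I -> set X) :
  (forall i, tau (F i)) -> tau (\bigcup_(i in [set: I]) F i).
Proof. by case: tauP => _ _ + _; apply. Qed.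

Lemma tauU A B : tau A -> tau B -> tau (A `|` B).
Proof.
move=> tA tB; rewrite -bigcup2E; apply: tau_bigcup.
by move=> [|[|i]] //=; exact: tau0.
Qed.

Lemma tau_nbhs A :
  (forall x, A x -> exists U, [/\ tau U, U x & U `<=` A]) -> tau A.
Proof.
move=> HA.
pose I := {U : set X | tau U /\ U `<=` A}.
have -> : A = \bigcup_(i in [set: I]) projT1 i.
  apply/seteqP; split => [x /HA[U [tU Ux UA]]|x [[U [tU UA]] _ /= /UA//]].
  by exists (exist _ U (conj tU UA)).
by apply: tau_bigcup => -[U []].
Qed.

(** Compactness as an induction principle: the open sets satisfying [P] cover [K], and a finite
    subcover is merged by stability under unions. Later arguments only have to choose [P]. *)
Lemma compact_top_ind (K : set X) (P : set X -> Prop) :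
  compact_top tau K -> P set0 -> (forall U V, P U -> P V -> P (U `|` V)) ->
  (forall x, K x -> exists U, [/\ tau U, P U & U x]) ->
  exists W, [/\ tau W, P W & K `<=` W].
Proof.
move=> cK P0 PU HK.
pose I := {U : set X | tau U /\ P U}.
have [] := cK I (fun i => projT1 i).
- by case=> U [].
- by move=> x /HK[U [tU pU Ux]]; exists (exist _ U (conj tU pU)).
move=> J finJ KJ.
suff [W [tW pW JW]] : exists W, [/\ tau W, P W &
    \bigcup_(i in J) (projT1 i) `<=` W].
  by exists W; split => //; exact: subset_trans JW.
have /(@finite_seqP {classic I})[s -> {J finJ KJ}] := finJ.
elim: s => [|[U [tU pU]] s IH].
  by exists set0; split => //; [exact: tau0|move=> x [] i].
have [W [tW pW sW]] := IH; exists (U `|` W); split.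
- exact: tauU.
- exact: PU.
move=> x [i /=]; rewrite inE => /orP[/eqP -> /= Ux|si ix]; first by left.
by right; apply: sW; exists i.
Qed.

Lemma compact_top_closedI K C :
  compact_top tau K -> tau (~` C) -> compact_top tau (K `&` C).
Proof.
move=> cK oC I F tF KF.
pose P W := exists2 J : set I, finite_set J & W `&` C `<=` \bigcup_(i in J) F i.
have [] := @compact_top_ind K P cK.
- by exists set0 => // x [].
- move=> U V [J fJ UJ] [J' fJ' VJ']; exists (J `|` J').
    by rewrite finite_setU.
  by move=> x [[Ux|Vx] Cx]; [have [i]:= UJ x (conj Ux Cx)|
    have [i]:= VJ' x (conj Vx Cx)] => Ji Fi; exists i => //; [left|right].
- move=> x Kx; have [Cx|nCx] := pselect (C x).
    have [i _ Fix] := KF x (conj Kx Cx).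
    exists (F i); split => //; exists [set i]; first exact: finite_set1.
    by move=> y [Fiy _]; exists i.
  exists (~` C); split => //; exists set0 => //.
  by move=> y [].
move=> W [_ [J fJ WJ] KW]; exists J => // x [Kx Cx]; apply: WJ; split => //.
exact: KW.
Qed.

Lemma compact_topU K L :
  compact_top tau K -> compact_top tau L -> compact_top tau (K `|` L).
Proof.
move=> cK cL I F tF KLF.
have [J fJ KJ] := cK I F tF (fun x Kx => KLF x (or_introl Kx)).
have [J' fJ' LJ'] := cL I F tF (fun x Lx => KLF x (or_intror Lx)).
exists (J `|` J'); first by rewrite finite_setU.
by move=> x [/KJ|/LJ'] [i Ji Fi]; exists i => //; [left|right].
Qed.

Lemma compact_top0 : compact_top tau set0.
Proof. by move=> I F _ _; exists set0. Qed.

Lemma compact_top_image (T : X -> X) K : continuous_top tau T ->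
  compact_top tau K -> compact_top tau (T @` K).
Proof.
move=> cT cK I F tF KF.
have [||J fJ KJ] := cK I (fun i => T @^-1` F i).
- by move=> i; exact: cT.
- by move=> x Kx; have [|i _ Fi] := KF (T x); [exists x|exists i].
by exists J => // _ [x /KJ[i Ji Fi] <-]; exists i.
Qed.

(** * Separation of compact sets in a Hausdorff topology *)

Hypothesis hausP : hausdorff_top tau.

Lemma compact_top_point_separated K x : compact_top tau K -> ~ K x ->
  exists U V, [/\ tau U, tau V, U x, K `<=` V & U `&` V = set0].
Proof.
move=> cK nKx.
pose P V := exists U, [/\ tau U, U x & U `&` V = set0].
have [] := @compact_top_ind K P cK.
- by exists setT; split => //; [exact: tauT|rewrite setI0].
- move=> V V' [U [tU Ux UV]] [U' [tU' Ux' UV']]; exists (U `&` U').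
  split => //; first exact: tauI.
  by rewrite setIUr setIAC UV set0I -setIA UV' setI0 setU0.
- move=> y Ky; have [//|U [V [tU tV Ux Vy UV]]] := @hausP x y.
    by move=> xy; apply: nKx; rewrite xy.
  by exists V; split => //; exists U.
by move=> V [tV [U [tU Ux UV]] KV]; exists U, V.
Qed.

Lemma compact_top_closed K : compact_top tau K -> tau (~` K).
Proof.
move=> cK; apply: tau_nbhs => x nKx.
have [U [V [tU tV Ux KV UV]]] := compact_top_point_separated cK nKx.
exists U; split => // y Uy Ky.
have : (U `&` V) y by split => //; exact: KV.
by rewrite UV.
Qed.

Lemma compact_top_separated K L :
  compact_top tau K -> compact_top tau L -> K `&` L = set0 ->
  exists U V, [/\ tau U, tau V, K `<=` U, L `<=` V & U `&` V = set0].
Proof.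
move=> cK cL KL.
pose P U := exists V, [/\ tau V, L `<=` V & U `&` V = set0].
have [] := @compact_top_ind K P cK.
- by exists setT; split => //; [exact: tauT|rewrite set0I].
- move=> U U' [V [tV LV UV]] [V' [tV' LV' UV']]; exists (V `&` V').
  split; [exact: tauI|by move=> x Lx; split; [exact: LV|exact: LV']|].
  by rewrite setIUl setIA UV set0I (setIC V) setIA UV' set0I setU0.
- move=> x Kx; have [|U [V [tU tV Ux LV UV]]] :=
    @compact_top_point_separated L x cL.
    by move=> Lx; have : (K `&` L) x := conj Kx Lx; rewrite KL.
  by exists U; split => //; exists V.
by move=> U [tU [V [tV LV UV]] KU]; exists U, V.
Qed.

(** The parts of [K] outside [U] and outside [V] are disjoint compact sets; removing disjoint open
    neighbourhoods of them from [K] leaves the two pieces. This makes [inner] subadditive. *)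
Lemma compact_top_setU_split K U V : compact_top tau K -> tau U -> tau V ->
  K `<=` U `|` V -> exists K1 K2, [/\ compact_top tau K1, compact_top tau K2,
    K1 `<=` U, K2 `<=` V & K = K1 `|` K2].
Proof.
move=> cK tU tV KUV.
have [|||A [B [tA tB KA KB AB]]] :=
    @compact_top_separated (K `&` ~` U) (K `&` ~` V).
- by apply: compact_top_closedI => //; rewrite setCK.
- by apply: compact_top_closedI => //; rewrite setCK.
- by apply/seteqP; split => // x [[Kx nU] [_ nV]]; case: (KUV _ Kx).
exists (K `&` ~` A), (K `&` ~` B); split.
- by apply: compact_top_closedI => //; rewrite setCK.
- by apply: compact_top_closedI => //; rewrite setCK.
- by move=> x [Kx nA]; apply: contrapT => nU; apply: nA; exact: KA.
- by move=> x [Kx nB]; apply: contrapT => nV; apply: nB; exact: KB.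
by rewrite -setIUr -setCI AB setC0 setIT.
Qed.

End topology_of_opens.

(** * The measure generated by a content *)

Section content_measure.
Context (R : realType) (X : ptopologicalType) (tau : set (set X)).
Hypotheses (tauP : is_topology tau) (hausP : hausdorff_top tau).
Variable m : set X -> \bar R.
Local Open Scope ereal_scope.
Hypothesis m0 : m set0 = 0.
Hypothesis m_mono : forall U V, tau U -> tau V -> U `<=` V -> m U <= m V.
Hypothesis m_subadd :
  forall U V, tau U -> tau V -> m (U `|` V) <= m U + m V.
Hypothesis m_superadd :
  forall U V, tau U -> tau V -> U `&` V = set0 -> m U + m V <= m (U `|` V).
Hypothesis mT : m setT < +oo.

Definition content K :=
  ereal_inf [set m U | U in [set U | tau U /\ K `<=` U]].

Definition inner U :=
  ereal_sup [set content K | K in [set K | compact_top tau K /\ K `<=` U]].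

Definition outer A :=
  ereal_inf [set inner U | U in [set U | tau U /\ A `<=` U]].

Lemma m_ge0 U : tau U -> 0 <= m U.
Proof. by move=> tU; rewrite -m0; apply: m_mono => //; exact: (tau0 tauP). Qed.

Lemma content_le K U : tau U -> K `<=` U -> content K <= m U.
Proof. by move=> tU KU; apply: ereal_inf_lbound; exists U. Qed.

Lemma le_content K x :
  (forall U, tau U -> K `<=` U -> x <= m U) -> x <= content K.
Proof. by move=> H; apply: le_ereal_inf_tmp => _ [U [tU KU] <-]; exact: H. Qed.

Lemma content_ge0 K : 0 <= content K.
Proof. by apply: le_content => U tU _; exact: m_ge0. Qed.

Lemma content_fin K : content K \is a fin_num.
Proof.
rewrite ge0_fin_numE ?content_ge0//.
by apply: le_lt_trans mT; apply: content_le => //; exact: (tauT tauP).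
Qed.

Lemma content_adherent K (e : R) : (0 < e)%R ->
  exists U, [/\ tau U, K `<=` U & m U <= content K + e%:E].
Proof.
move=> e0; have [_ [U [tU KU] <-] mU] :=
  lb_ereal_inf_adherent e0 (content_fin K).
by exists U; split => //; exact: ltW.
Qed.

Lemma content_subadd K L : content (K `|` L) <= content K + content L.
Proof.
apply/lee_addgt0Pr => e e0; have e20 : (0 < e / 2)%R by rewrite divr_gt0.
have [U [tU KU mU]] := content_adherent K e20.
have [V [tV LV mV]] := content_adherent L e20.
have -> : content K + content L + e%:E =
    (content K + (e / 2)%:E) + (content L + (e / 2)%:E).
  by rewrite addeACA -EFinD -splitr.
apply: le_trans (leeD mU mV); apply: le_trans (m_subadd tU tV).
by apply: content_le; [exact: tauU|exact: setUSS].
Qed.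

(** Disjoint open neighbourhoods of [K] and [L] cut every open [W] around the union into two
    disjoint open pieces, on which [m] is superadditive. *)
Lemma content_superadd K L : compact_top tau K -> compact_top tau L ->
  K `&` L = set0 -> content K + content L <= content (K `|` L).
Proof.
move=> cK cL KL; apply: le_content => W tW KLW.
have [U [V [tU tV KU LV UV]]] := compact_top_separated tauP hausP cK cL KL.
apply: (@le_trans _ _ (m (W `&` U) + m (W `&` V))).
  apply: leeD; apply: content_le; do ?exact: (tauI tauP).
  - by move=> x Kx; split; [apply: KLW; left|exact: KU].
  - by move=> x Lx; split; [apply: KLW; right|exact: LV].
apply: le_trans (m_superadd _ _ _) _; do ?exact: (tauI tauP).
  by rewrite setIACA UV setI0.
apply: m_mono => //; first by apply: (tauU tauP); exact: (tauI tauP).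
by move=> x [[]|[]].
Qed.

Lemma le_inner K U : compact_top tau K -> K `<=` U -> content K <= inner U.
Proof. by move=> cK KU; apply: ereal_sup_ubound; exists K. Qed.

Lemma inner_le U x :
  (forall K, compact_top tau K -> K `<=` U -> content K <= x) -> inner U <= x.
Proof. by move=> H; apply: ge_ereal_sup => _ [K [cK KU] <-]; exact: H. Qed.

Lemma inner_le_m U : tau U -> inner U <= m U.
Proof. by move=> tU; apply: inner_le => K cK KU; exact: content_le. Qed.

Lemma inner_ge0 U : 0 <= inner U.
Proof.
apply: le_trans (content_ge0 set0) _.
by apply: le_inner => //; exact: compact_top0.
Qed.

Lemma inner_mono U V : U `<=` V -> inner U <= inner V.
Proof.
move=> UV; apply: inner_le => K cK KU; apply: le_inner => //.
exact: subset_trans UV.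
Qed.

Lemma inner_fin U : inner U \is a fin_num.
Proof.
rewrite ge0_fin_numE ?inner_ge0//; apply: le_lt_trans mT.
apply: (@le_trans _ _ (inner setT)); first exact: inner_mono.
by apply: inner_le_m; exact: (tauT tauP).
Qed.

Lemma inner_adherent U (e : R) : (0 < e)%R ->
  exists K, [/\ compact_top tau K, K `<=` U & inner U <= content K + e%:E].
Proof.
move=> e0; have [_ [K [cK KU] <-] mU] :=
  ub_ereal_sup_adherent e0 (inner_fin U).
by exists K; split => //; rewrite -leeBlDr//; exact: ltW.
Qed.

Lemma inner_subadd U V : tau U -> tau V ->
  inner (U `|` V) <= inner U + inner V.
Proof.
move=> tU tV; apply: inner_le => K cK KUV.
have [K1 [K2 [cK1 cK2 K1U K2V ->]]] :=
  compact_top_setU_split tauP hausP cK tU tV KUV.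
by apply: le_trans (content_subadd _ _) _; apply: leeD; exact: le_inner.
Qed.

Lemma inner0 : inner set0 = 0.
Proof.
apply/eqP; rewrite eq_le inner_ge0 andbT -m0; apply: inner_le_m.
exact: (tau0 tauP).
Qed.

Lemma tau_bigsetU (U : nat -> set X) n : (forall i, tau (U i)) ->
  tau (\big[setU/set0]_(i < n) U i).
Proof.
move=> tU; apply: (big_ind tau) => //; first exact: (tau0 tauP).
by move=> *; exact: (tauU tauP).
Qed.

(** Countable subadditivity arises here although [m] is only finitely subadditive: a compact set
    inside the union already lies in a finite partial union. *)
Lemma inner_bigcup (U : nat -> set X) : (forall i, tau (U i)) ->
  inner (\bigcup_i U i) <= \sum_(i <oo) inner (U i).
Proof.
move=> tU; apply: inner_le => K cK KU.
have [] := @compact_top_ind _ _ tauP K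
  (fun W => exists n, W `<=` \big[setU/set0]_(i < n) U i) cK.
- by exists 0%N.
- move=> V W [n Vn] [k Wk]; exists (maxn n k) => x [/Vn|/Wk];
  apply: subset_bigsetU; [exact: leq_maxl|exact: leq_maxr].
- move=> x /KU[i _ Uix]; exists (U i); split => //; exists i.+1.
  by rewrite big_ord_recr/=; right.
move=> W [tW [n Wn] KW]; apply: (@le_trans _ _ (\sum_(0 <= i < n) inner (U i))).
  apply: (@le_trans _ _ (inner (\big[setU/set0]_(i < n) U i))).
    by apply: le_inner => //; exact: subset_trans Wn.
  elim: n {Wn} => [|n IH]; first by rewrite big_ord0 inner0 big_nil.
  rewrite big_ord_recr/= big_nat_recr//=.
  by apply: le_trans (inner_subadd _ _) _; rewrite ?leeD2r//; exact: tau_bigsetU.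
by apply: nneseries_lim_ge => *; exact: inner_ge0.
Qed.

Lemma outer_le A U : tau U -> A `<=` U -> outer A <= inner U.
Proof. by move=> tU AU; apply: ereal_inf_lbound; exists U. Qed.

Lemma le_outer A x :
  (forall U, tau U -> A `<=` U -> x <= inner U) -> x <= outer A.
Proof. by move=> H; apply: le_ereal_inf_tmp => _ [U [tU KU] <-]; exact: H. Qed.

Lemma outerE U : tau U -> outer U = inner U.
Proof.
move=> tU; apply/eqP; rewrite eq_le outer_le//=.
by apply: le_outer => V tV UV; exact: inner_mono.
Qed.

Lemma outer_ge0 A : 0 <= outer A.
Proof. by apply: le_outer => U _ _; exact: inner_ge0. Qed.

Lemma outer0 : outer set0 = 0.
Proof. by rewrite outerE ?inner0//; exact: (tau0 tauP). Qed.

Lemma outer_mono A B : A `<=` B -> outer A <= outer B.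
Proof.
move=> AB; apply: le_outer => U tU BU; apply: outer_le => //.
exact: subset_trans BU.
Qed.

Lemma outer_fin A : outer A \is a fin_num.
Proof.
rewrite ge0_fin_numE ?outer_ge0//.
apply: (@le_lt_trans _ _ (inner setT)); last by rewrite ltey_eq inner_fin.
by apply: outer_le => //; exact: (tauT tauP).
Qed.

Lemma outer_adherent A (e : R) : (0 < e)%R ->
  exists U, [/\ tau U, A `<=` U & inner U <= outer A + e%:E].
Proof.
move=> e0; have [_ [U [tU KU] <-] mU] :=
  lb_ereal_inf_adherent e0 (outer_fin A).
by exists U; split => //; exact: ltW.
Qed.

Lemma outer_sigma_subadd : sigma_subadditive outer.
Proof.
move=> F; apply/lee_addgt0Pr => e e0.
have /choice[U HU] i : exists U, [/\ tau U, F i `<=` U &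
    inner U <= outer (F i) + (e / (2 ^ i.+1)%:R)%:E].
  by apply: outer_adherent; rewrite divr_gt0// ltr0n expn_gt0.
apply: (@le_trans _ _ (inner (\bigcup_i U i))).
  apply: outer_le; first by apply: (tau_bigcup tauP) => i; case: (HU i).
  by move=> x [i _ Fi]; exists i => //; case: (HU i) => _ + _; apply.
apply: le_trans (inner_bigcup _) _; first by move=> i; case: (HU i).
apply: le_trans (epsilon_trick xpredT (fun i => outer_ge0 (F i)) (ltW e0)).
apply: lee_nneseries => [i *|i *]; first exact: inner_ge0.
by case: (HU i).
Qed.

HB.instance Definition _ := isOuterMeasure.Build R X outer outer0 outer_ge0
  outer_mono outer_sigma_subadd.

(** Approximate the part of [A] inside [U] by a compact [C], then [A] minus [C] by a compact [D].
    The latter set is open because compact sets are closed, and it contains [A] minus [U]; [C] and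
    [D] are disjoint, so their contents add up inside [A]. *)
Lemma inner_split A U : tau A -> tau U ->
  inner (A `&` U) + outer (A `&` ~` U) <= inner A.
Proof.
move=> tA tU; apply/lee_addgt0Pr => e e0.
have e20 : (0 < e / 2)%R by rewrite divr_gt0.
have [C [cC CAU hC]] := inner_adherent (A `&` U) e20.
have tAC : tau (A `&` ~` C).
  by apply: (tauI tauP) => //; exact: compact_top_closed.
have [D [cD DAC hD]] := inner_adherent (A `&` ~` C) e20.
apply: (@le_trans _ _ ((content C + (e / 2)%:E) + (content D + (e / 2)%:E))).
  apply: leeD => //; apply: le_trans hD; apply: outer_le => //.
  by move=> x [Ax nUx]; split => // Cx; apply: nUx; case: (CAU _ Cx).
rewrite addeACA -EFinD -splitr leeD2r//.
apply: le_trans (content_superadd cC cD _) _.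
  by apply/seteqP; split => // x [Cx /DAC[_]].
apply: le_inner; first exact: compact_topU.
by move=> x [/CAU[]|/DAC[]].
Qed.

Lemma caratheodory_tau U : tau U -> outer.-caratheodory U.
Proof.
move=> tU; apply: le_caratheodory_measurable => A.
apply: le_outer => W tW AW; apply: le_trans (inner_split tW tU).
apply: leeD; last by apply: outer_mono; exact: setSI.
rewrite -outerE; last exact: (tauI tauP).
by apply: outer_mono; exact: setSI.
Qed.

Hypothesis open_sigma_compact : forall U : set X, open U ->
  exists K : nat -> set X,
    (forall i, compact_top tau (K i)) /\ U = \bigcup_i K i.

(** An open set of [X] need not be in [tau], but it is a countable union of compact sets, whose
    complements are in [tau]. *)
Lemma caratheodory_borel (A : set (borel_of X)) :
  measurable A -> outer.-caratheodory A.
Proof.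
move: A; apply: smallest_sub.
  split; first exact: caratheodory_measurable_set0.
  - by move=> A mA; rewrite setTD; exact: caratheodory_measurable_setC.
  - exact: caratheodory_measurable_bigcup.
move=> U /open_sigma_compact[K [cK ->]].
apply: caratheodory_measurable_bigcup => i; rewrite -(setCK (K i)).
apply: caratheodory_measurable_setC; apply: caratheodory_tau.
exact: compact_top_closed.
Qed.

Lemma outer_semi_sigma_additive :
  semi_sigma_additive (outer : set (borel_of X) -> \bar R).
Proof.
move=> F mF tF mUF; apply: caratheodory_measure_sigma_additive => //.
- by move=> i; exact: caratheodory_borel.
- exact: caratheodory_borel.
Qed.

HB.instance Definition _ := isMeasure.Build _ (borel_of X) R
  (outer : set (borel_of X) -> \bar R) outer0 outer_ge0
  outer_semi_sigma_additive.

Lemma content_measure : exists mu : {measure set (borel_of X) -> \bar R},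
  forall A, mu A = outer A.
Proof. by exists (outer : set (borel_of X) -> \bar R). Qed.

Lemma content_le_outer K : compact_top tau K -> content K <= outer K.
Proof. by move=> cK; apply: le_outer => U tU KU; exact: le_inner. Qed.

(** * Effect of the map on the outer measure *)

Variable T : X -> X.
Hypothesis cT : continuous_top tau T.
Hypothesis mI : forall U, tau U -> m (T @^-1` U) <= m U.

(** Compact subsets of the preimage of [U] are pushed forward to compact subsets of [U], and open
    neighbourhoods of the image are pulled back. This gives one inequality; [limit_measure] recovers
    the other from complements. *)
Lemma outer_preimage A : outer (T @^-1` A) <= outer A.
Proof.
apply: le_outer => U tU AU.
apply: (@le_trans _ _ (inner (T @^-1` U))).
  by apply: outer_le; [exact: cT|exact: preimage_subset].
apply: inner_le => K cK KU; apply: (@le_trans _ _ (content (T @` K))).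
  apply: le_content => W tW KW; apply: le_trans (mI tW).
  by apply: content_le; [exact: cT|move=> x Kx; apply: KW; exists x].
apply: le_inner; first exact: compact_top_image.
by move=> _ [x Kx <-]; exact: KU.
Qed.

End content_measure.

(** * Limits of invariant averages *)

(** A cluster point exists because the segment is compact, and along an ultrafilter a cluster point
    is a limit. *)
Lemma ultra_cvg_itv (R : realType) (I : Type) (F : set_system I)
    (u : I -> R) (a b : R) :
  UltraFilter F -> (forall i, a <= u i <= b) -> cvg (u @ F).
Proof.
move=> FU uab.
have [l [_ ul]] : exists l, `[a, b]%classic l /\ cluster (u @ F) l.
  have [|l [abl cl]] := @segment_compact R a b (u @ F) _.
    by apply: (@filterE _ F) => i /=; rewrite in_itv/= uab.
  by exists l.
apply/cvg_ex; exists l => A lA; rewrite /nbhs/=.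
have [//|FnA] := in_ultra_setVsetC (u @^-1` A) FU.
by have [x []] := ul (~` A) A FnA lA.
Qed.

Lemma open_measurable_borel (X : ptopologicalType) (U : set X) :
  open U -> measurable (U : set (borel_of X)).
Proof. exact: sub_sigma_algebra. Qed.

Section limit_measure.
Context (R : realType) (X : ptopologicalType) (T : X -> X).
Context (tau : set (set X)).
Hypotheses (tauP : is_topology tau) (hausP : hausdorff_top tau).
Hypothesis tau_open : forall U, tau U -> open U.
Hypothesis cT : continuous_top tau T.
Hypothesis ctT : continuous T.
Hypothesis open_sigma_compact : forall U : set X, open U ->
  exists K : nat -> set X,
    (forall i, compact_top tau (K i)) /\ U = \bigcup_i K i.

Lemma compact_top_measurable K :
  compact_top tau K -> measurable (K : set (borel_of X)).
Proof.
move=> cK; rewrite -(setCK K); apply: measurableC.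
by apply: open_measurable_borel; apply: tau_open; exact: compact_top_closed.
Qed.

Lemma measurable_preimage A :
  measurable (A : set (borel_of X)) ->
  measurable (T @^-1` A : set (borel_of X)).
Proof.
move: A; apply: smallest_sub.
  split.
  - by rewrite /= preimage_set0; exact: measurable0.
  - by move=> A mA; rewrite /= setTD preimage_setC; exact: measurableC.
  - by move=> F mF; rewrite /= preimage_bigcup; exact: bigcupT_measurable.
move=> U oU; apply: open_measurable_borel; move/continuousP : ctT; exact.
Qed.

(** Common frame for orbit averages and for sequences of invariant probabilities. The mass is only
    bounded by [1], which admits the orbit average of length [0], equal to [0]. *)
Variable p : nat -> set X -> R.
Hypothesis p_ge0 : forall n A, 0 <= p n A.
Hypothesis p_le1 : forall n, p n setT <= 1.
Hypothesis p_add : forall n (A B : set (borel_of X)),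
  measurable A -> measurable B -> A `&` B = set0 ->
  p n (A `|` B) = p n A + p n B.
Hypothesis p_inv : forall U, tau U ->
  (fun n => p n (T @^-1` U) - p n U) @ \oo --> (0 : R).

Lemma p_mono n (A B : set (borel_of X)) : measurable A -> measurable B ->
  A `<=` B -> p n A <= p n B.
Proof.
move=> mA mB AB; rewrite -(setDUK AB) p_add ?setDIK//; last exact: measurableD.
by rewrite lerDl p_ge0.
Qed.

Lemma p_bound n (A : set (borel_of X)) : measurable A -> 0 <= p n A <= 1.
Proof.
move=> mA; rewrite p_ge0/=; apply: le_trans (p_le1 n).
by apply: p_mono => //; exact: measurableT.
Qed.

(** Mass may escape, as [X] is not assumed compact; the lower bound [e] on [K0] keeps the limit
    nonzero, so that it can be normalised. *)
Lemma limit_measure K0 (e : R) : compact_top tau K0 -> 0 < e ->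
  (\forall n \near \oo, e <= p n K0) ->
  exists nu : probability (borel_of X) R, invariant_measure T nu /\
    forall K r, compact_top tau K -> (\forall n \near \oo, r <= p n K) ->
      (r%:E <= nu K)%E.
Proof.
move=> cK0 e0 eK0.
(* [F] refines the filter of eventual properties, so eventual bounds on [p] survive in the limit. *)
have [F [FU sF]] := ultraFilterLemma (eventually_filter : ProperFilter \oo).
pose l (A : set X) := lim ((p^~ A) @ F).
have lP (A : set (borel_of X)) : measurable A -> (p^~ A) @ F --> l A.
  by move=> mA; apply: (@ultra_cvg_itv _ _ _ _ 0 1) => i; exact: p_bound.
have lmono (A B : set (borel_of X)) : measurable A -> measurable B ->
    A `<=` B -> l A <= l B.
  move=> mA mB AB; apply: ler_lim; [exact: lP|exact: lP|].
  by apply: nearW => n; exact: p_mono.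
have ladd (A B : set (borel_of X)) : measurable A -> measurable B ->
    A `&` B = set0 -> l (A `|` B) = l A + l B.
  move=> mA mB AB; apply/cvg_lim => //.
  rewrite (_ : p^~ (A `|` B) = fun n => p n A + p n B).
    by apply: cvgD; exact: lP.
  by apply/funext => n; rewrite p_add.
have mtau U : tau U -> measurable (U : set (borel_of X)).
  by move=> tU; apply: open_measurable_borel; exact: tau_open.
pose m A := (l A)%:E.
have m0 : m set0 = 0%E.
  have : l set0 = l set0 + l set0.
    by rewrite -ladd ?setU0 ?setI0//; exact: measurable0.
  by move/eqP; rewrite -subr_eq subrr eq_sym => /eqP l0; rewrite /m l0.
have m_mono U V : tau U -> tau V -> U `<=` V -> (m U <= m V)%E.
  by move=> tU tV UV; rewrite lee_fin; apply: lmono => //; exact: mtau.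
have m_super U V : tau U -> tau V -> U `&` V = set0 ->
    (m U + m V <= m (U `|` V))%E.
  by move=> tU tV UV; rewrite -EFinD lee_fin ladd//; exact: mtau.
have m_sub U V : tau U -> tau V -> (m (U `|` V) <= m U + m V)%E.
  move=> /mtau mU /mtau mV; rewrite -EFinD lee_fin.
  have -> : U `|` V = U `|` (V `\` U) by rewrite setDE setUIr setUCr setIT.
  rewrite ladd ?setDIK//; last exact: measurableD.
  by rewrite lerD2l; apply: lmono => //; exact: measurableD.
have mT : (m setT < +oo)%E by rewrite ltry.
have mI U : tau U -> (m (T @^-1` U) <= m U)%E.
  move=> tU; rewrite lee_fin -subr_le0.
  have lTU : (fun n => p n (T @^-1` U) - p n U) @ F --> l (T @^-1` U) - l U.
    by apply: cvgB; apply: lP; apply: mtau => //; exact: cT.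
  have lTU0 : (fun n => p n (T @^-1` U) - p n U) @ F --> (0 : R).
    by apply: cvg_trans (p_inv tU); apply: cvg_app; exact: sF.
  by rewrite (cvg_unique _ lTU lTU0).
have [mu muE] := content_measure tauP hausP m0 m_mono m_sub m_super mT
  open_sigma_compact.
have le_mu K r : compact_top tau K -> (\forall n \near \oo, r <= p n K) ->
    (r%:E <= mu K)%E.
  move=> cK rK; rewrite muE; apply: le_trans (content_le_outer _ cK).
  apply: le_content => U tU KU; rewrite lee_fin.
  apply: (@le_trans _ _ (l K)).
    apply: limr_ge; first by apply: lP; exact: compact_top_measurable.
    exact: sF.
  by apply: lmono => //; [exact: compact_top_measurable|exact: mtau].
have mu_fin A : mu A \is a fin_num.
  by rewrite muE; exact: (outer_fin tauP m0 m_mono mT).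
have muT1 : (mu setT <= 1)%E.
  rewrite muE outerE; last exact: (tauT tauP).
  apply: le_trans (inner_le_m _ (tauT tauP)) _; rewrite lee_fin.
  apply: limr_le; first by apply: lP; exact: measurableT.
  exact: nearW.
have muC (A : set (borel_of X)) : measurable A ->
    mu (~` A) = (mu setT - mu A)%E.
  move=> mA; rewrite -setTD measureD ?setTI ?ltey_eq ?mu_fin//.
have mu_inv (A : set (borel_of X)) : measurable A -> mu (T @^-1` A) = mu A.
  move=> mA; have mTA := measurable_preimage mA.
  apply/eqP; rewrite eq_le; apply/andP; split.
    by rewrite !muE; exact: (outer_preimage cT mI).
  (* The same inequality for the complement gives the reverse one, the total mass being finite. *)
  have : (mu (~` (T @^-1` A)) <= mu (~` A))%E.
    by rewrite !muE; exact: (outer_preimage cT mI).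
  rewrite !muC//.
  have /fineK <- := mu_fin setT.
  have /fineK <- := mu_fin A.
  have /fineK <- := mu_fin (T @^-1` A).
  by rewrite -!EFinB !lee_fin lerD2l lerN2.
have muT0 : (0 < mu setT)%E.
  apply: (@lt_le_trans _ _ e%:E); first by rewrite lte_fin.
  apply: le_trans (le_mu _ _ cK0 eK0) _; apply: le_measure => //; rewrite inE.
    exact: compact_top_measurable.
  exact: measurableT.
pose nu : probability (borel_of X) R := mnormalize mu point.
have nuE A : nu A = (mu A * (fine (mu setT))^-1%:E)%E.
  by rewrite /nu/= /mnormalize gt_eqF//= lt_eqF// ltey_eq mu_fin.
exists nu; split=> [A mA|K r cK rK]; first by rewrite !nuE mu_inv.
(* As [mu setT] is at most [1], normalising can only increase values, so lower bounds persist. *)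
apply: le_trans (le_mu _ _ cK rK) _; rewrite nuE lee_pemulr// lee_fin.
have fmuT0 : 0 < fine (mu setT) by rewrite fine_gt0// muT0 ltey_eq mu_fin.
by rewrite invf_ge1// -lee_fin fineK.
Qed.

End limit_measure.

(** * Countable families of compact sets *)

Lemma polish_countable_base (R : realType) (X : ptopologicalType) :
  polish R X -> exists B : nat -> set X, (forall i, open (B i)) /\
    forall U x, open U -> U x -> exists i, B i x /\ B i `<=` U.
Proof.
move=> [[D [cD clD]] [d [[d0 deq dC dtri dopen] _]]].
have [h hinj] := countable_injP D cD.
(* [g] inverts the injection [h] of the dense set [D] into the naturals, with [point] as default
   value. *)
have /choice[g gP] i : exists x, forall y, D y -> h y = i -> y = x.
  have [[x [Dx hx]]|nx] := pselect (exists x, D x /\ h x = i).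
    exists x => y Dy hy; apply: hinj; rewrite ?inE//.
    by rewrite hy.
  by exists point => y Dy hy; exfalso; apply: nx; exists y.
pose ball' x (e : R) := [set y | d x y < e].
have dxx x : d x x = 0 by apply/deq.
have open_ball x e : open (ball' x e).
  apply/dopen => y /= xy; exists (e - d x y); first by rewrite subr_gt0.
  by move=> z /=; rewrite ltrBrDl; apply: le_lt_trans.
pose B n := if (unpickle n : option (nat * nat)) is Some (i, k)
  then ball' (g i) k.+1%:R^-1 else set0.
exists B; split.
  by move=> n; rewrite /B; case: unpickle => [[i k]|]; [exact: open_ball|exact: open0].
move=> U x oU Ux; have [e e0 eU] := (dopen U).1 oU _ Ux.
have [k ke] : exists k, k.+1%:R^-1 < e / 2.
  have e20 : 0 < e / 2 by rewrite divr_gt0.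
  have [k _ /(_ k (leqnn k))/= ke] := near_infty_natSinv_lt (PosNum e20).
  by exists k.
have [] : (D `&` ball' x k.+1%:R^-1) !=set0.
  have : closure D x by rewrite clD.
  apply; apply: open_nbhs_nbhs; split; first exact: open_ball.
  by rewrite /ball'/= dxx invr_gt0.
move=> y [Dy xy]; exists (pickle (h y, k)).
rewrite /B pickleK -(gP _ _ Dy erefl); split; first by rewrite /ball'/= dC.
move=> z /= yz; apply: eU => /=; apply: le_lt_trans (dtri _ y _) _.
by rewrite (splitr e) ltrD//; exact: lt_trans ke.
Qed.

Section compact_family.
Context (R : realType) (X : ptopologicalType) (tau : set (set X)).
Hypotheses (tauP : is_topology tau) (hausP : hausdorff_top tau).
Hypothesis tau_open : forall U, tau U -> open U.
Hypothesis compact_basis : forall (x : X) (N : set X), nbhs x N ->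
  exists K : set X, [/\ nbhs x K, compact_top tau K & K `<=` N].
Hypothesis polX : polish R X.

(** For each pair of basic open sets choose a compact set between them if there is one. If [B k] is
    a basic neighbourhood of [x] inside [U], a compact neighbourhood of [x] inside [B k] contains
    some [B j] around [x], so the pair [(j, k)] has such a set. *)
Lemma exists_compact_family : exists L : nat -> set X,
  (forall i, compact_top tau (L i)) /\
  forall U x, open U -> U x -> exists i, L i x /\ L i `<=` U.
Proof.
have [B [oB BP]] := polish_countable_base polX.
pose good j k K := [/\ compact_top tau K, B j `<=` K & K `<=` B k].
have /choice[L LP] n : exists K, compact_top tau K /\
    forall j k, (unpickle n : option (nat * nat)) = Some (j, k) ->
      (exists K', good j k K') -> good j k K.
  case: unpickle => [[j k]|]; last by exists set0; split; [exact: compact_top0|].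
  have [[K [cK jK Kk]]|nK] := pselect (exists K, good j k K).
    by exists K; split => // _ _ [<- <-].
  by exists set0; split; [exact: compact_top0|move=> _ _ [<- <-] /nK].
exists L; split; first by move=> n; case: (LP n).
move=> U x oU Ux; have [k [Bkx kU]] := BP _ _ oU Ux.
have [|K [xK cK Kk]] := compact_basis (x := x) (N := B k).
  by apply: open_nbhs_nbhs.
have [j [Bjx jK]] : exists j, B j x /\ B j `<=` K.
  have [j [Bjx jK]] := BP K^° x (open_interior K) xK.
  by exists j; split => //; apply: subset_trans jK _; exact: interior_subset.
have [_ /(_ j k)] := LP (pickle (j, k)); rewrite pickleK => /(_ erefl)[].
  by exists K.
move=> _ jL Lk; exists (pickle (j, k)); split; first exact: jL.
exact: subset_trans kU.
Qed.

Lemma open_sigma_compact (U : set X) : open U -> exists K : nat -> set X,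
  (forall i, compact_top tau (K i)) /\ U = \bigcup_i K i.
Proof.
move=> oU; have [L [cL LP]] := exists_compact_family.
exists (fun i => if `[< L i `<=` U >] then L i else set0); split.
  by move=> i; case: ifP => // _; exact: compact_top0.
apply/seteqP; split => [x Ux|x [i _]].
  by have [i [Lix LU]] := LP _ _ oU Ux; exists i => //; case: asboolP.
by case: asboolP => // LU; exact: LU.
Qed.

(* The family is closed under finite unions, so that every open set is the
   union of an increasing sequence of its members. *)
Lemma exists_determining_family : exists M : nat -> set X,
  (forall i, compact_top tau (M i)) /\
  forall m1 m2 : probability (borel_of X) R,
    (forall i, m1 (M i) = m2 (M i)) ->
    forall A : set (borel_of X), measurable A -> m1 A = m2 A.
Proof.
have [L [cL LP]] := exists_compact_family.
pose M n := \big[setU/set0]_(i <- CodeSeq.decode n) L i.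
have cM n : compact_top tau (M n).
  rewrite /M; apply: (big_ind (compact_top tau)) => //; first exact: compact_top0.
  by move=> *; exact: compact_topU.
exists M; split => // m1 m2 m12.
(* The open sets form a generating family stable under intersections; on them, continuity from below
   along the sets [F n] gives the equality. *)
apply: (@measure_unique _ R (borel_of X) (@open X) (fun=> setT)) => //.
- by move=> A B; exact: openI.
- by move=> i; exact: openT.
- by apply/seteqP; split => // x _; exists 0%N.
- move=> U oU.
  pose s n := [seq i <- iota 0 n | `[< L i `<=` U >]].
  pose F n := M (CodeSeq.code (s n)).
  have FE n x : F n x <-> exists i, [/\ (i < n)%N, L i `<=` U & L i x].
    rewrite /F /M CodeSeq.codeK -bigcup_seq; split.
      by move=> [i /=]; rewrite mem_filter mem_iota add0n/= => /andP[/asboolP]; exists i.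
    move=> [i [ni LU Lx]]; exists i => //=.
    by rewrite mem_filter mem_iota add0n/= ni andbT; apply/asboolP.
  have UE : U = \bigcup_n F n.
    apply/seteqP; split => [x Ux|x [n _ /FE[i [_ LU Lx]]]]; last exact: LU.
    have [i [Lix LU]] := LP _ _ oU Ux; exists i.+1 => //; apply/FE.
    by exists i.
  have mF n : measurable (F n : set (borel_of X)).
    by apply: (compact_top_measurable tauP hausP tau_open); exact: cM.
  have ndF : nondecreasing_seq F.
    move=> n k nk; apply/subsetPset => x /FE[i [ni LU Lx]]; apply/FE.
    by exists i; split => //; exact: leq_trans nk.
  have mU : measurable (\bigcup_n F n : set (borel_of X)).
    exact: bigcupT_measurable.
  have := @nondecreasing_cvg_mu _ (borel_of X) R m2 F mF mU ndF.
  rewrite [m2 \o F](_ : _ = m1 \o F); last by apply/funext => n /=; rewrite -m12.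
  move/cvg_lim => /(_ (@ereal_hausdorff _)).
  have /cvg_lim := @nondecreasing_cvg_mu _ (borel_of X) R m1 F mF mU ndF.
  by move=> /(_ (@ereal_hausdorff _)) -> ; rewrite -UE.
- by move=> n; rewrite (le_lt_trans (probability_le1 _ _)) ?ltry//; exact: measurableT.
Qed.

End compact_family.

(** * Frequency of visits *)

Lemma limn_einf_gt0P (R : realType) (u : nat -> R) :
  (0 < limn_einf (fun n => (u n)%:E))%E <->
  exists2 e, 0 < e & \forall n \near \oo, e <= u n.
Proof.
rewrite limn_einf_lim (cvg_lim _ (@cvg_einfs_sup R _))//; split.
  move=> /ereal_sup_gt[_ [n _ <-]]; rewrite /einfs/=.
  set I := ereal_inf _ => I0.
  have IE k : (n <= k)%N -> (I <= (u k)%:E)%E.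
    by move=> nk; apply: ereal_inf_lbound; exists k.
  case: I I0 IE => [r| |]// r0 IE; first exists r => //.
    by exists n => // k /= /IE; rewrite lee_fin.
  by have := IE n (leqnn n).
move=> [e e0 [n _ ne]]; apply: (@lt_le_trans _ _ e%:E); first by rewrite lte_fin.
apply: le_trans (ereal_sup_ubound _); last by exists n.
by apply: le_ereal_inf_tmp => _ [k /= nk <-]; rewrite lee_fin ne.
Qed.

Section visits.
Context (X : ptopologicalType) (T : X -> X).

Lemma visitsD x V n k :
  visits T x V (n + k) = (visits T x V n + visits T (iter n T x) V k)%N.
Proof.
rewrite /visits iotaD count_cat (addnC 1%N n) iotaDl count_map.
congr addn; apply: eq_count => i /=.
by rewrite -iterD addnC.
Qed.

Lemma visits1 x V : visits T x V 1 = `[< V (T x) >].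
Proof. by rewrite /visits/= addn0. Qed.

Lemma visits_le x V n : (visits T x V n <= n)%N.
Proof. by rewrite -[X in (_ <= X)%N](size_iota 1) count_size. Qed.

Lemma visitsE (R : realType) x V n :
  (visits T x V n)%:R = \sum_(k < n) \1_V (iter k.+1 T x) :> R.
Proof.
elim: n => [|n IH]; first by rewrite big_ord0.
rewrite big_ord_recr/= -IH -addn1 visitsD natrD visits1; congr (_ + _).
Qed.

(* Cut the orbit segment of length [N] greedily at the points outside [B] into
   blocks of length at most [M] on which the frequency of visits is at most
   [e]; the last block is incomplete and costs at most [M]. *)
Lemma visits_covering (R : realType) (V B : set X) (e : R) (M : nat) :
  0 <= e ->
  (forall x, ~ B x -> exists n, [/\ (0 < n)%N, (n <= M)%N &
     (visits T x V n)%:R <= e * n%:R]) ->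
  forall N x,
    (visits T x V N)%:R <= e * N%:R + M%:R + \sum_(k < N) \1_B (iter k T x).
Proof.
move=> e0 HB N; elim/ltn_ind: N => -[_ x|N IH x].
  by rewrite big_ord0 addr0 mulr0 add0r ler_nat.
have [Bx|nBx] := pselect (B x).
  (* The possible visit at time [1] is paid by the term [k = 0] of the indicator sum: visits are
     counted from time [1], the sum starts at time [0]. *)
  rewrite -add1n visitsD natrD visits1 big_ord_recl/=.
  have -> : \1_B x = 1 :> R by rewrite indicE mem_set.
  have := IH N (ltnSn N) (T x).
  have -> : \sum_(k < N) \1_B (iter k T (T x)) =
      \sum_(k < N) \1_B (iter (bump 0 k) T x) :> R.
    by apply: eq_bigr => k _; rewrite -iterSr.
  have : (`[< V (T x) >] : nat)%:R <= 1 :> R by case: asbool; rewrite ?ler01.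
  rewrite natrD.
  lra.
have [n [n0 nM hn]] := HB x nBx.
have [nN|Nn] := leqP n N.+1; last first.
  apply: (@le_trans _ _ M%:R).
    by rewrite ler_nat (leq_trans (visits_le _ _ _))// (leq_trans _ nM)// ltnW.
  rewrite -addrA [X in _ <= X]addrCA lerDl addr_ge0 ?mulr_ge0//.
  by apply: sumr_ge0 => i _; rewrite indicE.
rewrite -(subnKC nN) visitsD natrD big_split_ord/=.
have Nn : (N.+1 - n < N.+1)%N by rewrite ltn_subrL n0.
have := IH _ Nn (iter n T x).
have -> : \sum_(k < N.+1 - n) \1_B (iter k T (iter n T x)) =
    \sum_(k < N.+1 - n) \1_B (iter (n + k) T x) :> R.
  by apply: eq_bigr => k _; rewrite -iterD addnC.
have : 0 <= \sum_(k < n) \1_B (iter k T x) :> R.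
  by apply: sumr_ge0 => i _; rewrite indicE.
rewrite [(n + (N.+1 - n))%:R]natrD.
lra.
Qed.

End visits.

(** * Positive lower density from an invariant probability *)

Section invariant_recurrence.
Context (R : realType) (X : ptopologicalType) (T : X -> X).
Hypothesis ctT : continuous T.
Variable mu : probability (borel_of X) R.
Hypothesis muT : invariant_measure T mu.

Lemma iter_preimage_invariant (A : set (borel_of X)) n : measurable A ->
  measurable (iter n T @^-1` A : set (borel_of X)) /\
  mu (iter n T @^-1` A) = mu A.
Proof.
move=> mA; elim: n => [//|n [mn IH]].
have -> : iter n.+1 T @^-1` A = T @^-1` (iter n T @^-1` A).
  by apply/seteqP; split => x; rewrite /preimage/= -iterSr.
by split; [exact: measurable_preimage|rewrite muT].
Qed.

(** The offset [c] serves both time conventions: [c = 1] counts visits, [c = 0] gives the indicator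
    sum of [visits_covering]. *)
Definition birkhoff_sum (A : set X) c n (x : borel_of X) : R :=
  \sum_(k < n) \1_A (iter (c + k) T x).

Lemma measurable_birkhoff_sum (A : set (borel_of X)) c n :
  measurable A -> measurable_fun setT (birkhoff_sum A c n).
Proof.
move=> mA; apply: measurable_sum => k.
have [mk _] := iter_preimage_invariant (c + k) mA.
exact: (measurable_indic mk).
Qed.

Lemma integral_birkhoff_sum (A : set (borel_of X)) c n : measurable A ->
  (\int[mu]_x (birkhoff_sum A c n x)%:E = n%:R%:E * mu A)%E.
Proof.
move=> mA; under eq_integral do rewrite /birkhoff_sum -sumEFin.
rewrite ge0_integral_sum//.
- rewrite (eq_bigr (fun=> mu A)).
    by rewrite sumr_const card_ord -muleC mule_natr.
  move=> k _; have [mk <-] := iter_preimage_invariant (c + k) mA.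
  by rewrite -[in RHS](setIT (_ @^-1` _)) -integral_indic.
- move=> k; apply/measurable_EFinP.
  have [mk _] := iter_preimage_invariant (c + k) mA.
  exact: (measurable_indic mk).
Qed.

(** If the orbit visits [V], restart from the visited point, where low frequencies occur at
    arbitrarily late times [n]; the first [k.+1] steps are absorbed once [n] is large. Otherwise one
    step suffices. *)
Lemma exists_low_frequency_time (V : set X) (e : R) : 0 < e ->
  (forall x, V x -> ~ (0 < lower_density_visits R T x V)%E) ->
  forall x, exists n, (visits T x V n.+1)%:R <= e * n.+1%:R.
Proof.
move=> e0 HV x.
have [[k Vk]|nV] := pselect (exists k, V (iter k.+1 T x)); last first.
  exists 0%N; rewrite visits1; case: asboolP => [Vx|_]; last by rewrite mulr1 ltW.
  by exfalso; apply: nV; exists 0%N.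
have e20 : 0 < e / 2 by rewrite divr_gt0.
have [n0 n0e] : exists n0, k.+1%:R <= e / 2 * n0%:R.
  exists (Num.bound (k.+1%:R / (e / 2))); rewrite mulrC -ler_pdivrMr// ltW//.
  by rewrite archi_boundP// divr_ge0// ltW.
have [n n0n hn] : exists2 n, (n0 < n)%N &
    (visits T (iter k.+1 T x) V n)%:R / n%:R < e / 2.
  apply: contrapT => Hn; apply: (HV _ Vk); apply/limn_einf_gt0P.
  exists (e / 2) => //; exists n0.+1 => // n /= n0n; rewrite leNgt.
  by apply/negP => hn; apply: Hn; exists n.
exists (k + n)%N; rewrite -addSn visitsD natrD.
move: hn; rewrite ltr_pdivrMr; last by rewrite ltr0n (leq_trans _ n0n).
have : (visits T x V k.+1)%:R <= k.+1%:R :> R by rewrite ler_nat visits_le.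
have : e / 2 * n0%:R <= e / 2 * n%:R by rewrite ler_pM2l// ler_nat ltnW.
have : 0 <= e * k.+1%:R by rewrite mulr_ge0 ?ltW.
rewrite natrD mulrDr; set a := e * n%:R.
have -> : e / 2 * n%:R = a / 2 by rewrite /a mulrAC.
lra.
Qed.

(** Integrating [visits_covering] turns frequencies along orbits into an upper bound for [mu V],
    which is too small if no point of [V] has positive lower density. *)
Lemma exists_positive_lower_density (V : set (borel_of X)) :
  measurable V -> (0 < mu V)%E ->
  exists2 x, V x & (0 < lower_density_visits R T x V)%E.
Proof.
move=> mV muV; apply: contrapT => HV.
have muf (A : set (borel_of X)) : measurable A -> mu A \is a fin_num.
  by move=> mA; exact: fin_num_measure.
pose v := fine (mu V).
have v0 : 0 < v by rewrite fine_gt0// muV ltey_eq muf.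
(* Three errors of at most [e] will bound [v], from the block frequency, the incomplete block and
   the exceptional set; hence the factor [4]. *)
pose e := v / 4; have e0 : 0 < e by rewrite divr_gt0.
have Hlow := exists_low_frequency_time e0
  (fun x Vx dx => HV (ex_intro2 _ _ x Vx dx)).
pose G n : set (borel_of X) := [set x | (visits T x V n.+1)%:R <= e * n.+1%:R].
have mG n : measurable (G n).
  have := measurable_birkhoff_sum 1 n.+1 mV.
  move=> /(_ measurableT `]-oo, e * n.+1%:R]%classic (measurable_itv _)).
  rewrite setTI; congr measurable; apply/funext => x.
  by rewrite /G /preimage/= in_itv/= (visitsE T R).
(* Points without a low-frequency time up to [M]; by [Hlow] these sets decrease to the empty set. *)
pose B M := \bigcap_(n < M) ~` G n.
have mB M : measurable (B M).
  by apply: bigcap_measurableType => n _; exact: measurableC.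
have [M muBM] : exists M, (mu (B M) < e%:E)%E.
  have : mu \o B @ \oo --> mu (\bigcap_M B M).
    apply: nonincreasing_cvg_mu => //.
    - by rewrite ltey_eq muf.
    - exact: bigcapT_measurable.
    - by move=> n k nk; apply/subsetPset => x Bx i /= ni; apply: Bx => /=;
        exact: leq_trans nk.
  rewrite (_ : \bigcap_M B M = set0); last first.
    apply/seteqP; split => // x Bx; have [n Gn] := Hlow x.
    by exact: (Bx n.+1 _ n (ltnSn n)).
  rewrite measure0 => /fine_cvgP[_ /cvgrPdist_lt /(_ e e0)[M _ /(_ M)]] /=.
  rewrite sub0r normrN => /(_ (leqnn M)) h; exists M.
  by rewrite -(fineK (muf _ (mB M))) lte_fin (le_lt_trans (ler_norm _)).
have cover := @visits_covering X T R V (B M) e M (ltW e0).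
have {}cover N x : birkhoff_sum V 1 N x <=
    e * N%:R + M%:R + birkhoff_sum (B M) 0 N x.
  have := cover _ N x; rewrite (visitsE T R); apply => {}x nBx.
  apply: contrapT => hx; apply: nBx => n /= nM Gn; apply: hx.
  by exists n.+1.
have bound N : (N%:R%:E * mu V <= (e * N%:R + M%:R)%:E + N%:R%:E * mu (B M))%E.
  rewrite -(integral_birkhoff_sum 1 N mV) -(integral_birkhoff_sum 0 N (mB M)).
  have -> : ((e * N%:R + M%:R)%:E = \int[mu]_x (cst (e * N%:R + M%:R)%:E) x)%E.
    by rewrite integral_cst// [X in (_ * X)%E]probability_setT mule1.
  have c0 : 0 <= e * N%:R + M%:R by rewrite addr_ge0// mulr_ge0// ltW.
  have S0 A c x : 0 <= birkhoff_sum A c N x.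
    by apply: sumr_ge0 => i _; rewrite indicE.
  have mS (A : set (borel_of X)) c : measurable A ->
      measurable_fun setT (fun x => (birkhoff_sum A c N x)%:E).
    by move=> mA; apply/measurable_EFinP; exact: measurable_birkhoff_sum.
  rewrite -ge0_integralD//; try exact: mS.
    apply: ge0_le_integral => //; try exact: mS.
    - by move=> x _; rewrite lee_fin S0.
    - by apply: emeasurable_funD => //; exact: mS.
    - by move=> x _; rewrite -EFinD lee_fin; exact: cover.
  by move=> x _; rewrite lee_fin S0.
pose b := fine (mu (B M)).
have be : b < e by rewrite -lte_fin fineK ?muf.
have {}bound N : N%:R * v <= e * N%:R + M%:R + N%:R * b.
  by have := bound N; rewrite -(fineK (muf _ mV)) -(fineK (muf _ (mB M))).
pose N := Num.bound (M%:R / e).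
have MN : M%:R < e * N%:R.
  by rewrite mulrC -ltr_pdivrMr// archi_boundP// divr_ge0// ltW.
have N0 : 0 < (N%:R : R) by rewrite -(pmulr_rgt0 _ e0) (le_lt_trans _ MN).
have : N%:R * b < N%:R * e by rewrite ltr_pM2l.
have := bound N; have -> : v = 4 * e by rewrite /e; lra.
have : 0 < e * N%:R by rewrite mulr_gt0.
nra.
Qed.

End invariant_recurrence.

(** * Ergodic measures as lexicographic maximisers *)

Section conditional_probability.
Context (R : realType) (X : ptopologicalType) (T : X -> X).
Variables (mu : probability (borel_of X) R) (A : set (borel_of X)).
Hypotheses (mA : measurable A) (muA : (0 < mu A)%E).

Definition pcond : probability (borel_of X) R :=
  mnormalize (mrestr mu mA) point.

Lemma pcondE B : (pcond B = mu (B `&` A) * (fine (mu A))^-1%:E)%E.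
Proof.
rewrite /pcond/= /mnormalize/= /mrestr setTI gt_eqF//= lt_eqF//.
by rewrite ltey_eq fin_num_measure.
Qed.

Lemma pcond_invariant : invariant_measure T mu -> T @^-1` A = A ->
  invariant_measure T pcond.
Proof.
move=> muT TA B mB; rewrite !pcondE; congr (_ * _)%E.
by rewrite -{1}TA -preimage_setI; apply: muT; exact: measurableI.
Qed.

End conditional_probability.

Section ergodic_existence.
Context (R : realType) (X : ptopologicalType) (T : X -> X).
Context (tau : set (set X)).
Hypotheses (tauP : is_topology tau) (hausP : hausdorff_top tau).
Hypothesis tau_open : forall U, tau U -> open U.
Hypothesis cT : continuous_top tau T.
Hypothesis ctT : continuous T.
Hypothesis compact_basis : forall (x : X) (N : set X), nbhs x N ->
  exists K : set X, [/\ nbhs x K, compact_top tau K & K `<=` N].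
Hypothesis polX : polish R X.

Let compact_measurable := compact_top_measurable tauP hausP tau_open.

Local Notation prob := (probability (borel_of X) R).

(** A form of upper semicontinuity of the values on compact sets, with [K0] preventing the loss of
    all mass. The defect of invariance required by [limit_measure] is identically zero here. *)
Lemma invariant_limit (mu_ : nat -> prob) K0 (e : R) :
  (forall n, invariant_measure T (mu_ n)) -> compact_top tau K0 -> 0 < e ->
  (\forall n \near \oo, e%:E <= mu_ n K0)%E ->
  exists nu : prob, invariant_measure T nu /\
    forall K r, compact_top tau K -> (\forall n \near \oo, r%:E <= mu_ n K)%E ->
      (r%:E <= nu K)%E.
Proof.
move=> mu_inv cK0 e0 eK0.
have fin n (A : set (borel_of X)) : measurable A -> mu_ n A \is a fin_num.
  by move=> mA; exact: fin_num_measure.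
have near_fine K (r : R) : compact_top tau K ->
    (\forall n \near \oo, r%:E <= mu_ n K)%E ->
    \forall n \near \oo, r <= fine (mu_ n K).
  move=> cK; apply: filterS => n.
  by rewrite -(fineK (fin n _ (compact_measurable cK))) lee_fin.
have [||n A B mA mB AB|U tU|nu [nu_inv nuP]] := @limit_measure R X T tau
    tauP hausP tau_open cT ctT (open_sigma_compact compact_basis polX)
    (fun n A => fine (mu_ n A)) _ _ _ _ K0 e cK0 e0 (near_fine _ _ cK0 eK0).
- by move=> n A; exact: fine_ge0.
- by move=> n; rewrite [mu_ n _]probability_setT.
- by rewrite -fineD ?fin// measureU.
- have -> : (fun n => fine (mu_ n (T @^-1` U)) - fine (mu_ n U)) = cst 0.
    apply/funext => n; rewrite mu_inv ?subrr//.
    by apply: open_measurable_borel; exact: tau_open.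
  exact: cvg_cst.
by exists nu; split => // K r cK /(near_fine _ _ cK); exact: nuP.
Qed.

(** * Lexicographic maximisation over invariant probabilities *)

Section lexicographic.
Variables (K : nat -> set X) (mu0 : prob).
Hypothesis cK : forall n, compact_top tau (K n).
Hypotheses (mu0_inv : invariant_measure T mu0) (mu0K : (0 < mu0 (K 0%N))%E).

(** Stage [n] has settled the values on [K i] for [i < n], so all its members agree there. *)
Fixpoint lexmax n : set prob :=
  if n is k.+1 then
    [set mu | lexmax k mu /\ forall nu, lexmax k nu -> (nu (K k) <= mu (K k))%E]
  else [set mu | invariant_measure T mu].

Lemma lexmax_leq n k : (n <= k)%N -> lexmax k `<=` lexmax n.
Proof.
elim: k => [|k IH]; first by rewrite leqn0 => /eqP ->.
rewrite leq_eqVlt => /orP[/eqP -> //|]; rewrite ltnS => /IH nk mu [+ _].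
exact: nk.
Qed.

Lemma lexmax_le n i (mu nu : prob) : (i < n)%N -> lexmax n mu -> lexmax n nu ->
  (mu (K i) <= nu (K i))%E.
Proof.
move=> ni mun nun; have [_] := lexmax_leq ni nun; apply.
exact: (lexmax_leq (ltnW ni)).
Qed.

(** Only lower bounds are asked of [nu], which is what limits provide; the maximality of [rho]
    carries over to any invariant probability doing at least as well. *)
Lemma lexmax_intro n (rho nu : prob) : lexmax n rho -> invariant_measure T nu ->
  (forall i, (i < n)%N -> (rho (K i) <= nu (K i))%E) -> lexmax n nu.
Proof.
move=> + nu_inv; elim: n => [//|n IH] [rhon rhomax] le_nu; split.
  by apply: IH => // i ni; apply: le_nu; exact: leqW.
by move=> xi xin; apply: le_trans (rhomax _ xin) (le_nu _ _).
Qed.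

Let muK_fin (mu : prob) n : mu (K n) \is a fin_num.
Proof. by rewrite fin_num_measure//; exact: compact_measurable. Qed.

(** A sequence in stage [n] maximising the value on [K n] has a limit by [invariant_limit];
    [lexmax_intro] keeps the values on the earlier sets. *)
Lemma lexmax_nonempty n : lexmax n !=set0.
Proof.
elim: n => [|n [rho rhon]]; first by exists mu0.
pose S := [set mu (K n) | mu in lexmax n]; pose s := ereal_sup S.
have le_s mu : lexmax n mu -> (mu (K n) <= s)%E.
  by move=> mun; apply: ereal_sup_ubound; exists mu.
have s_fin : s \is a fin_num.
  rewrite ge0_fin_numE; last exact: le_trans (le_s _ rhon).
  rewrite (@le_lt_trans _ _ 1%E)// ?ltry//; apply: ge_ereal_sup => _ [mu _ <-].
  by apply: probability_le1; exact: compact_measurable.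
(* Half of the initial mass on [K 0]: at stage [0] a near maximiser may fall short of the supremum
   by [e] and still has at least [e] there; at later stages nothing is lost. *)
pose e := fine (mu0 (K 0%N)) / 2.
have e0 : 0 < e by rewrite divr_gt0// fine_gt0// mu0K ltey_eq muK_fin.
have e2 : mu0 (K 0%N) = (e + e)%:E by rewrite -splitr fineK.
have /choice[mu_ mu_P] k : exists mu, lexmax n mu /\
    (s <= mu (K n) + (e / k.+1%:R)%:E)%E.
  have ek0 : 0 < e / k.+1%:R by rewrite divr_gt0.
  have [_ [mu mun <-] /ltW h] := ub_ereal_sup_adherent ek0 s_fin.
  by exists mu; split => //; rewrite -leeBlDr.
have [|nu [nu_inv nuP]] :=
    @invariant_limit mu_ (K 0%N) e (fun k => lexmax_leq (leq0n n) (mu_P k).1)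
    (@cK 0%N) e0.
  apply: nearW => k; have [mukn hk] := mu_P k.
  case: (posnP n) => [n0|n0].
    move: hk (le_s mu0); rewrite n0 => hk /(_ mu0_inv); rewrite e2 => h.
    have := le_trans h hk; rewrite -(fineK (muK_fin (mu_ k) 0%N)).
    rewrite -EFinD !lee_fin => h'.
    have : e / k.+1%:R <= e by rewrite ler_pdivrMr// ler_peMr ?ler1n// ltW.
    rewrite -(lerD2l e) => hke.
    by rewrite -(lerD2r (e / k.+1%:R)); exact: le_trans h'.
  have [_ /(_ mu0 mu0_inv)] := lexmax_leq n0 mukn; apply: le_trans.
  by rewrite e2 lee_fin lerDl ltW.
exists nu; split.
  apply: (lexmax_intro rhon) => // i ni; rewrite -(fineK (muK_fin rho i)).
  apply: nuP => //; apply: nearW => k; rewrite fineK//.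
  by rewrite (lexmax_le ni)//; case: (mu_P k).
move=> xi /le_s /le_trans; apply; rewrite -(fineK s_fin).
apply/lee_addgt0Pr => d d0.
rewrite -leeBlDr// -EFinB; apply: nuP => //.
have [k0 k0d] : exists k0 : nat, e / d < k0%:R.
  by exists (Num.bound (e / d)); rewrite archi_boundP// divr_ge0// ltW.
exists k0 => // k /= k0k; have [_] := mu_P k.
rewrite -(fineK s_fin) -(fineK (muK_fin (mu_ k) n)) -EFinD !lee_fin.
have : e / k.+1%:R <= d.
  rewrite ler_pdivrMr// mulrC -ler_pdivrMr// (le_trans (ltW k0d))// ler_nat.
  exact: leqW.
rewrite fineK// lerBlDr => hd /le_trans; apply.
by rewrite lerD2l.
Qed.

(** Diagonal choice: from index [n] on, all members of the sequence share the optimal values on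
    [K i] for [i < n], and the limit does at least as well. *)
Lemma exists_lexmax : exists nu, forall n, lexmax n nu.
Proof.
have /choice[mu_ mu_P] := lexmax_nonempty.
have [||||nu [nu_inv nuP]] := @invariant_limit mu_ (K 0%N) (fine (mu0 (K 0%N))).
- by move=> n; exact: (lexmax_leq (leq0n n)).
- exact: cK.
- by rewrite fine_gt0// mu0K ltey_eq muK_fin.
- exists 1%N => // n /= n0; rewrite fineK//.
  by have [_] := lexmax_leq n0 (mu_P n); exact.
exists nu => n; apply: (lexmax_intro (mu_P n)) => // i ni.
rewrite -(fineK (muK_fin (mu_ n) i)); apply: nuP => //.
exists n => // k /= nk; rewrite fineK//.
by rewrite (lexmax_le ni)//; exact: (lexmax_leq nk).
Qed.

Hypothesis detK : forall m1 m2 : prob,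
  (forall i, m1 (K i) = m2 (K i)) ->
  forall A : set (borel_of X), measurable A -> m1 A = m2 A.

(* A lexicographic maximiser is an extreme point: the two conditional
   probabilities on an invariant set and on its complement are again
   lexicographic maximisers, hence equal to it. *)
Lemma lexmax_ergodic (nu : prob) : (forall n, lexmax n nu) -> ergodic_measure T nu.
Proof.
move=> nuP; have nu_inv := nuP 0%N; split => // A mA TA.
have [nuA0|nuA0] := eqVneq (nu A) 0%E; first by left.
have nuA : (0 < nu A)%E by rewrite lt_neqAle eq_sym nuA0 measure_ge0.
have mCA := measurableC mA.
have [nuCA0|nuCA0] := eqVneq (nu (~` A)) 0%E.
  right; have := nuCA0; rewrite probability_setC//.
  rewrite -(fineK (fin_num_measure nu _ mA)) -EFinB => -[/eqP].
  by rewrite subr_eq0 => /eqP <-.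
have nuCA : (0 < nu (~` A))%E by rewrite lt_neqAle eq_sym nuCA0 measure_ge0.
pose nu1 := pcond nu mA; pose nu2 := pcond nu mCA.
have inv1 : invariant_measure T nu1 by exact: pcond_invariant.
have inv2 : invariant_measure T nu2.
  by apply: pcond_invariant => //; rewrite -[in RHS]TA.
pose a := fine (nu A); pose b := fine (nu (~` A)).
have a0 : 0 < a by rewrite fine_gt0// nuA ltey_eq fin_num_measure.
have b0 : 0 < b by rewrite fine_gt0// nuCA ltey_eq fin_num_measure.
have ab : a + b = 1.
  rewrite /a /b -fineD ?fin_num_measure// -measureU// ?setICr//.
  by rewrite setUCr [X in fine X]probability_setT.
have split_nu B : measurable (B : set (borel_of X)) ->
    fine (nu B) = a * fine (nu1 B) + b * fine (nu2 B).
  move=> mB; have mBA := measurableI _ _ mB mA.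
  have mBCA := measurableI _ _ mB mCA.
  rewrite /nu1 /nu2 !pcondE// !fineM ?fin_num_measure//= -/a -/b.
  rewrite [a * _]mulrC [b * _]mulrC -!mulrA mulVf ?mulVf ?gt_eqF// !mulr1.
  rewrite -fineD ?fin_num_measure// -measureU//.
    by rewrite -setIUr setUCr setIT.
  by rewrite setIACA setICr setI0.
(* On [K n] neither conditional probability exceeds [nu], which is their convex combination with
   positive weights; hence equality, and both pass to the next stage. *)
have eqK n : lexmax n nu1 -> lexmax n nu2 ->
    nu1 (K n) = nu (K n) /\ nu2 (K n) = nu (K n).
  move=> n1 n2; have [_ numax] := nuP n.+1.
  have fine_eq (m : prob) :
      fine (m (K n)) = fine (nu (K n)) -> m (K n) = nu (K n).
    by move=> h; rewrite -(fineK (muK_fin m n)) h fineK.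
  have fine_le (m : prob) : lexmax n m -> fine (m (K n)) <= fine (nu (K n)).
    by move=> /numax; rewrite -lee_fin !fineK.
  have := split_nu _ (compact_measurable (@cK n)).
  move: (fine_le _ n1) (fine_le _ n2) (fine_eq nu1) (fine_eq nu2).
  set x := fine (nu (K n)); set y := fine (nu1 _); set z := fine (nu2 _).
  move=> yx zx eq1 eq2 xyz.
  have ayx : a * y <= a * x by rewrite ler_pM2l.
  have bzx : b * z <= b * x by rewrite ler_pM2l.
  have xab : x = a * x + b * x by rewrite -mulrDl ab mul1r.
  split; [apply: eq1|apply: eq2]; apply/eqP; rewrite eq_le ?yx ?zx/=.
    by rewrite -(ler_pM2l a0); lra.
  by rewrite -(ler_pM2l b0); lra.
have lex12 n : lexmax n nu1 /\ lexmax n nu2.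
  elim: n => [//|n [n1 n2]]; have [e1 e2] := eqK n n1 n2.
  have [_ numax] := nuP n.+1.
  by split; split => //; rewrite ?e1 ?e2.
(* Since [nu1] agrees with [nu] on Borel sets, [nu A] equals [nu1 A], which is [1]. *)
right; rewrite -(@detK nu1 nu)//.
  rewrite /nu1 pcondE// setIid -(fineK (fin_num_measure nu _ mA)) -EFinM.
  by rewrite divff ?gt_eqF.
by move=> i; have [n1 n2] := lex12 i; have [] := eqK i n1 n2.
Qed.

End lexicographic.

Lemma full_support_ergodic (mu : prob) :
  invariant_measure T mu -> full_support mu ->
  forall V : set X, open V -> V !=set0 ->
    exists nu : prob, ergodic_measure T nu /\ (0 < nu V)%E.
Proof.
move=> mu_inv mu_full V oV [x Vx].
have [|K0 [xK0 cK0 K0V]] := compact_basis (x := x) (N := V).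
  exact: open_nbhs_nbhs.
have [M [cM detM]] :=
  exists_determining_family tauP hausP tau_open compact_basis polX.
(* [K0] comes first, so the maximiser gives it at least the mass [mu K0]; the shifted family [M]
   still determines measures. *)
pose K n := if n is k.+1 then M k else K0.
have cK n : compact_top tau (K n) by case: n.
have muK : (0 < mu (K 0%N))%E.
  apply: lt_le_trans (mu_full K0^° (open_interior _) _) _; first by exists x.
  apply: le_measure; rewrite ?inE; last exact: interior_subset.
    by apply: open_measurable_borel; exact: open_interior.
  exact: compact_measurable.
have [nu nuP] := exists_lexmax cK mu_inv muK.
exists nu; split.
  by apply: (lexmax_ergodic cK _ nuP) => m1 m2 m12; apply: detM => i; exact: (m12 i.+1).
apply: lt_le_trans muK _; apply: (@le_trans _ _ (nu K0)).
  by have [_] := nuP 1%N; exact.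
apply: le_measure; rewrite ?inE//; first exact: compact_measurable.
exact: open_measurable_borel.
Qed.

End ergodic_existence.

(** * Invariant measures of full support *)

Section orbit_averages.
Context (R : realType) (X : ptopologicalType) (T : X -> X) (x : X).

Definition orbit_average N (A : set X) : R := (visits T x A N)%:R / N%:R.

Lemma orbit_average_ge0 N A : 0 <= orbit_average N A.
Proof. by rewrite divr_ge0. Qed.

Lemma orbit_average_le1 N A : orbit_average N A <= 1.
Proof.
rewrite /orbit_average; case: N => [|N]; first by rewrite invr0 mulr0.
by rewrite ler_pdivrMr// mul1r ler_nat visits_le.
Qed.

Lemma orbit_averageU N A B : A `&` B = set0 ->
  orbit_average N (A `|` B) = orbit_average N A + orbit_average N B.
Proof.
move=> AB; rewrite /orbit_average -mulrDl !(visitsE T R) -big_split/=.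
congr (_ / _); apply: eq_bigr => k _.
rewrite !indicE in_setU; set y := T _.
have [yA|yA] := boolP (y \in A); have [yB|yB] := boolP (y \in B) => /=;
  rewrite ?addr0 ?add0r//.
have : (A `&` B) y by split; exact: set_mem.
by rewrite AB.
Qed.

(** Visits to the preimage are visits shifted by one unit of time, so the two counts differ by end
    terms only, by at most [1], which vanishes after division by [N]. *)
Lemma orbit_average_preimage A :
  (fun N => orbit_average N (T @^-1` A) - orbit_average N A) @ \oo --> (0 : R).
Proof.
apply/cvgrPdist_lt => e e0; near=> N; rewrite sub0r normrN -mulrBl normrM.
have N0 : 0 < (N%:R : R) by rewrite ltr0n; near: N; exact: nbhs_infty_gt.
rewrite [`|N%:R^-1|]ger0_norm ?invr_ge0// ltr_pdivrMr//.
apply: (@le_lt_trans _ _ 1); last first.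
  rewrite -ltr_pdivrMl// mulr1; near: N; exact: nbhs_infty_gtr.
have vT : visits T x (T @^-1` A) N = visits T (T x) A N.
  by rewrite /visits; apply: eq_count => i /=; rewrite -iterS iterSr.
have := visitsD T x A 1 N; rewrite addnC visitsD !visits1 -vT/=.
have b1 (b : bool) : 0 <= (b%:R : R) <= 1 by case: b; rewrite ?lexx ?ler01.
move=> /(congr1 (fun n => n%:R : R)); rewrite !natrD.
have := b1 `[< A (T x) >]; have := b1 `[< A (T (iter N T x)) >].
move=> /andP[? ?] /andP[? ?] ?.
by rewrite ler_norml; apply/andP; split; lra.
Unshelve. all: by end_near. Qed.

End orbit_averages.

Section full_support_existence.
Context (R : realType) (X : ptopologicalType) (T : X -> X).
Local Notation prob := (probability (borel_of X) R).

(** Each nonempty basic open set gets a measure charging it, an empty one gets [nu0]. The mixture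
    with weights [1 / 2 ^ i.+1] charges every nonempty open set; only the bound [1] on its mass is
    proved, so it is normalised at the end. *)
Lemma full_support_of_local : polish R X ->
  (forall V : set X, open V -> V !=set0 ->
    exists nu : prob, invariant_measure T nu /\ (0 < nu V)%E) ->
  exists mu : prob, invariant_measure T mu /\ full_support mu.
Proof.
move=> polX HV; have [B [oB BP]] := polish_countable_base polX.
have [|nu0 [nu0_inv _]] := HV setT openT; first by exists point.
have /choice[nu nuP] i : exists nu : prob, invariant_measure T nu /\
    (B i !=set0 -> (0 < nu (B i))%E).
  have [/(HV _ (oB i))[nu [nu_inv nuB]]|nB] := pselect (B i !=set0).
    by exists nu.
  by exists nu0.
have w0 i : 0 < 1 / (2 ^ i.+1)%:R :> R by rewrite divr_gt0// ltr0n expn_gt0.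
pose mu_ i : {measure set (borel_of X) -> \bar R} :=
  mscale (NngNum (ltW (w0 i))) (nu i).
pose mu : {measure set (borel_of X) -> \bar R} := mseries mu_ 0.
have muE A : (mu A = \sum_(i <oo) ((1 / (2 ^ i.+1)%:R)%:E * nu i A))%E by [].
have mu_fin : (mu setT <= 1)%E.
  rewrite muE; apply: le_trans (epsilon_trick0 xpredT (@ler01 R)).
  apply: lee_nneseries => [i _|i _]; first by rewrite mule_ge0// lee_fin ltW.
  by rewrite [X in (_ * X)%E]probability_setT mule1.
have mu_supp V : open V -> V !=set0 -> (0 < mu V)%E.
  move=> oV [x Vx]; have [i [Bx BV]] := BP _ _ oV Vx.
  have [_ /(_ (ex_intro _ x Bx)) nuB] := nuP i.
  have term0 k : (0 <= (1 / (2 ^ k.+1)%:R)%:E * nu k V)%E.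
    by rewrite mule_ge0// lee_fin ltW.
  rewrite muE; apply: (@lt_le_trans _ _ ((1 / (2 ^ i.+1)%:R)%:E * nu i V)%E).
    rewrite mule_gt0// ?lte_fin//; apply: lt_le_trans nuB _.
    by apply: le_measure; rewrite ?inE//; exact: open_measurable_borel.
  apply: le_trans (nneseries_lim_ge i.+1 _); last by move=> *; exact: term0.
  by rewrite big_nat_recr//= leeDr// sume_ge0.
have muT0 : (0 < mu setT)%E by apply: mu_supp; [exact: openT|exists point].
have muT_fin : mu setT \is a fin_num.
  by rewrite ge0_fin_numE// (le_lt_trans mu_fin)// ltry.
pose P : prob := mnormalize mu point.
have PE A : (P A = mu A * (fine (mu setT))^-1%:E)%E.
  by rewrite /P/= /mnormalize gt_eqF//= lt_eqF// ltey_eq muT_fin.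
exists P; split => [A mA|V oV V0]; rewrite ?PE.
  congr (_ * _)%E; rewrite !muE; apply: eq_eseriesr => i _.
  by have [-> //] := nuP i.
rewrite mule_gt0//; first exact: mu_supp.
by rewrite lte_fin invr_gt0 fine_gt0// muT0 ltey_eq muT_fin.
Qed.

End full_support_existence.

(** * Equivalence of the three conditions *)

Theorem proposition2 (R : realType) (X : ptopologicalType) (T : X -> X)
  (tau : set (set X)) :
  polish R X ->
  continuous T ->
  is_topology tau ->
  hausdorff_top tau ->
  (forall U, tau U -> open U) ->
  (forall (x : X) (N : set X), nbhs x N ->
     exists K : set X, [/\ nbhs x K, compact_top tau K & K `<=` N]) ->
  continuous_top tau T ->
  [<-> (exists mu : probability (borel_of X) R,
          invariant_measure T mu /\ full_support mu);
       (forall V : set X, open V -> V !=set0 ->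
          exists mu : probability (borel_of X) R,
            ergodic_measure T mu /\ (0 < mu V)%E);
       frequently_recurrent R T].
Proof.
move=> polX ctT tauP hausP tau_open compact_basis cT.
do !split.
- move=> [mu [mu_inv mu_full]].
  exact: (full_support_ergodic tauP hausP tau_open cT ctT compact_basis polX
    mu_inv mu_full).
- move=> erg V oV V0; have [mu [[mu_inv _] muV]] := erg V oV V0.
  apply: (exists_positive_lower_density ctT mu_inv) => //.
  exact: open_measurable_borel.
move=> rec; apply: full_support_of_local => // V oV [y Vy].
have [|K [yK cK KV]] := compact_basis y V; first exact: open_nbhs_nbhs.
(* Recurrence is applied to the interior of a compact [K] inside [V], because [limit_measure]
   transfers lower bounds on compact sets. *)
have [|x _ /limn_einf_gt0P[e e0 eK]] := rec K^° (open_interior K).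
  by exists y.
have near_K : \forall N \near \oo, e <= orbit_average R T x N K.
  apply: filterS eK => N /le_trans; apply.
  rewrite ler_wpM2r ?invr_ge0// ler_nat /visits.
  by apply: sub_count => i /asboolP/interior_subset Ki; apply/asboolP.
have [|||||nu [nu_inv nuP]] := @limit_measure R X T tau tauP hausP tau_open cT
    ctT (open_sigma_compact compact_basis polX) (orbit_average R T x)
    _ _ _ _ K e cK e0.
- exact: orbit_average_ge0.
- by move=> N; exact: orbit_average_le1.
- by move=> N A B _ _; exact: orbit_averageU.
- by move=> U _; exact: orbit_average_preimage.
- exact: near_K.
exists nu; split => //; apply: (@lt_le_trans _ _ e%:E); first by rewrite lte_fin.
apply: (@le_trans _ _ (nu K)).
  exact: nuP.
apply: le_measure; rewrite ?inE//; last exact: open_measurable_borel.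
exact: (compact_top_measurable tauP hausP tau_open).
Qed.
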